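(* Let $A=(a_{ijk})$, $i,j,k\in\{1,2\}$, be a nonzero hypermatrix of format $(2,2,2)$ with entries in $\mathbb{C}$, with associated $2\times 2$ matrices of linear forms $L,M,N$, so that $\det L\in\mathbb{C}[x_1,x_2]$, $\det M\in\mathbb{C}[y_1,y_2]$, $\det N\in\mathbb{C}[z_1,z_2]$ are binary quadratic forms (possibly zero). Then exactly one of the following cases occurs, and in each case the stated conclusions hold. (1) $\det L$ has two distinct zeros in $\mathbb{P}^1$. Then $\mathrm{Det}(A)\ne 0$, $A$ is concise and the tensor rank of $A$ is $2$. (2) $\det L$, $\det M$ and $\det N$ all are nonzero with a double root. Then $\mathrm{Det}(A)=0$, $A$ is concise and the tensor rank of $A$ is $3$. (3) Two among $\det L,\det M,\det N$ vanish identically and the other is nonzero with a double root. Then $\mathrm{Det}(A)=0$, $A$ is not concise, the tensor rank of $A$ is $2$, and $F_{ess}(A)$ is $(1,2,2)$, $(2,1,2)$ or $(2,2,1)$ according to whether the form with a double root is $\det L$, $\det M$ or $\det N$, respectively. (4) $\det L=\det M=\det N=0$. Then $\mathrm{Det}(A)=0$, the tensor rank of $A$ is $1$, $A$ is not concise and $F_{ess}(A)=(1,1,1)$. Moreover, whenever $\det L$ has a double root or is $0$, the schemes $\mathcal L,\mathcal M,\mathcal N$ are all degenerate.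
   Context: Associated matrices: $L=(L_{jk})$ with $L_{jk}=\sum_i a_{ijk}x_i$; $M=(M_{ik})$ with $M_{ik}=\sum_j a_{ijk}y_j$; $N=(N_{ij})$ with $N_{ij}=\sum_k a_{ijk}z_k$. The associated schemes $\mathcal L,\mathcal M,\mathcal N\subseteq\mathbb{P}^1$ are defined by $\det L$, $\det M$, $\det N$ respectively; such a scheme is called degenerate if it contains a point at which both partial derivatives of the defining form vanish. Hyperdeterminant of format $(2,2,2)$: $\mathrm{Det}(A)=a_{111}^2a_{222}^2+a_{112}^2a_{221}^2+a_{121}^2a_{212}^2+a_{122}^2a_{211}^2-2(a_{111}a_{112}a_{221}a_{222}+a_{111}a_{121}a_{212}a_{222}+a_{111}a_{122}a_{211}a_{222}+a_{112}a_{121}a_{212}a_{221}+a_{112}a_{122}a_{221}a_{211}+a_{121}a_{122}a_{212}a_{211})+4(a_{111}a_{122}a_{212}a_{221}+a_{112}a_{121}a_{211}a_{222})$. Tensor rank of $A$: the minimal number of decomposable tensors $u\otimes v\otimes w$ whose sum is $\sum a_{ijk}\,\varepsilon_i\otimes\eta_j\otimes\zeta_k\in\mathbb{C}^2\otimes\mathbb{C}^2\otimes\mathbb{C}^2$, where $(\varepsilon_i),(\eta_j),(\zeta_k)$ are the fixed bases. Conciseness and essential format: let $P_A=\sum a_{ijk}x_iy_jz_k$. The essential format $F_{ess}(A)$ is the (componentwise) minimum $(p',q',r')$ such that there are linear forms $x'_1,\dots,x'_{p'}$ in the $x_i$, $y'_1,\dots,y'_{q'}$ in the $y_j$, $z'_1,\dots,z'_{r'}$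 in the $z_k$ with $P_A$ a trihomogeneous polynomial of degree $(1,1,1)$ in $x',y',z'$. $A$ is concise if $F_{ess}(A)=(2,2,2)$. *)

(* Defs.v *)
From HB Require Import structures.
From mathcomp Require Import all_boot all_order all_algebra.
From mathcomp Require Import mpoly complex reals.

Set Implicit Arguments.
Unset Strict Implicit.
Unset Printing Implicit Defensive.

Import GRing.Theory.
Local Open Scope ring_scope.

(* Indices 1, 2 of the hypermatrix are the elements 0, 1 of 'I_2. *)
Definition hypermatrix222 (K : fieldType) := 'I_2 -> 'I_2 -> 'I_2 -> K.

Section Hypermatrix.
Variable K : fieldType.
Implicit Types (a : hypermatrix222 K) (f : {mpoly K[2]}).

Definition matL a : 'M[{mpoly K[2]}]_2 :=
  \matrix_(j, k) \sum_i a i j k *: 'X_i.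
Definition matM a : 'M[{mpoly K[2]}]_2 :=
  \matrix_(i, k) \sum_j a i j k *: 'X_j.
Definition matN a : 'M[{mpoly K[2]}]_2 :=
  \matrix_(i, j) \sum_k a i j k *: 'X_k.

(* Points of P^1 are nonzero row vectors, taken up to nonzero scalars. *)
Definition point (v : 'rV[K]_2) : Prop := v != 0.
Definition same_point (u v : 'rV[K]_2) : Prop :=
  exists2 c : K, c != 0 & u = c *: v.

Definition zero_at f (v : 'rV[K]_2) : Prop := f.@[v 0] = 0.

(* Exactly two points of P^1; in particular f is not the zero form. *)
Definition two_distinct_zeros f : Prop :=
  exists u v : 'rV[K]_2,
    [/\ point u, point v, ~ same_point u v &
        forall w, point w ->
          (zero_at f w <-> same_point w u \/ same_point w v)].

(* v_2 x_1 - v_1 x_2 is, up to scalars, the linear form vanishing at v; a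
   double root is a point at which f vanishes with multiplicity >= 2. *)
Definition double_root f : Prop :=
  exists2 v : 'rV[K]_2, point v &
    exists g : {mpoly K[2]}, f = g * (v 0 1 *: 'X_0 - v 0 0 *: 'X_1) ^+ 2.

Definition nonzero_with_double_root f : Prop := f != 0 /\ double_root f.

(* Degeneracy of the subscheme of P^1 defined by f. *)
Definition degenerate f : Prop :=
  exists v : 'rV[K]_2,
    [/\ point v, zero_at f v & forall i : 'I_2, zero_at f^`M(i) v].

Definition hyperdet a : K :=
  let a111 := a 0 0 0 in let a112 := a 0 0 1 in
  let a121 := a 0 1 0 in let a122 := a 0 1 1 in
  let a211 := a 1 0 0 in let a212 := a 1 0 1 in
  let a221 := a 1 1 0 in let a222 := a 1 1 1 in
  a111 ^+ 2 * a222 ^+ 2 + a112 ^+ 2 * a221 ^+ 2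
  + a121 ^+ 2 * a212 ^+ 2 + a122 ^+ 2 * a211 ^+ 2
  - 2 * (a111 * a112 * a221 * a222 + a111 * a121 * a212 * a222
         + a111 * a122 * a211 * a222 + a112 * a121 * a212 * a221
         + a112 * a122 * a221 * a211 + a121 * a122 * a212 * a211)
  + 4 * (a111 * a122 * a212 * a221 + a112 * a121 * a211 * a222).

(* A tensor of K^2 (x) K^2 (x) K^2 is given by its coordinates in the fixed
   bases, so that u (x) v (x) w has coordinates u_i v_j w_k. *)
Definition sum_of_decomposables a (r : nat) : Prop :=
  exists u v w : 'I_r -> 'rV[K]_2,
    forall i j k, a i j k = \sum_(s < r) u s 0 i * v s 0 j * w s 0 k.

Definition tensor_rank a (r : nat) : Prop :=
  sum_of_decomposables a r /\
  forall s, sum_of_decomposables a s -> (r <= s)%N.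

(* The variables indexed by 'I_(p + q + r) are split into three blocks: p
   variables x, then q variables y, then r variables z. *)
Section Blocks.
Variables p q r : nat.

Definition idx_x (i : 'I_p) : 'I_(p + q + r) := lshift r (lshift q i).
Definition idx_y (j : 'I_q) : 'I_(p + q + r) := lshift r (rshift p j).
Definition idx_z (k : 'I_r) : 'I_(p + q + r) := rshift (p + q) k.

Definition trihomogeneous (d e f : nat) (Q : {mpoly K[p + q + r]}) : Prop :=
  forall m : 'X_{1..p + q + r}, m \in msupp Q ->
    [/\ (\sum_i m (idx_x i) = d)%N, (\sum_j m (idx_y j) = e)%N &
        (\sum_k m (idx_z k) = f)%N].

Definition block_tuple (T : Type) (x : 'I_p -> T) (y : 'I_q -> T)
    (z : 'I_r -> T) : (p + q + r).-tuple T :=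
  [tuple match split t with
         | inl s => match split s with inl i => x i | inr j => y j end
         | inr k => z k
         end | t < p + q + r].

End Blocks.

Definition trilinear_form a : {mpoly K[2 + 2 + 2]} :=
  \sum_i \sum_j \sum_k
    a i j k *: ('X_(idx_x 2 2 i) * 'X_(idx_y 2 2 j) * 'X_(idx_z 2 2 k)).

(* Row l of cx, cy, cz holds the coefficients of the linear forms x'_l, y'_l,
   z'_l respectively. *)
Definition format_achieved a (p q r : nat) : Prop :=
  exists (cx : 'M[K]_(p, 2)) (cy : 'M[K]_(q, 2)) (cz : 'M[K]_(r, 2))
         (Q : {mpoly K[p + q + r]}),
    trihomogeneous 1 1 1 Q /\
    trilinear_form a = Q \mPo block_tuple
                (fun l => \sum_i cx l i *: 'X_(idx_x 2 2 i))
                (fun l => \sum_j cy l j *: 'X_(idx_y 2 2 j))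
                (fun l => \sum_k cz l k *: 'X_(idx_z 2 2 k)).

Definition essential_format a (p q r : nat) : Prop :=
  format_achieved a p q r /\
  forall p' q' r', format_achieved a p' q' r' ->
    [/\ (p <= p')%N, (q <= q')%N & (r <= r')%N].

Definition concise a : Prop := essential_format a 2 2 2.

End Hypermatrix.

Definition exactly_one (s : seq Prop) : Prop := exists! i : nat, nth False s i.

(* Main.v *)
(** The three forms det L, det M, det N have the same discriminant, namely the
    hyperdeterminant.  Hence Det(A) != 0 exactly when det L has two distinct
    zeros; the slices of A at these zeros have rank one and span the pencil, so
    A has rank 2.  If Det(A) = 0, each form is zero or has a double root.  The
    flattening of A along x has rank at most one iff det M = det N = 0, and
    det L = 0 forces det M = 0 or det N = 0 because every coefficient at y_j^2
    of det M times every coefficient at z_k^2 of det N lies in the ideal of the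
    coefficients of det L.  So no, two or all three of the forms vanish.  When
    none vanishes, rank at most 2 is excluded since for
    A = u (x) v (x) w + u' (x) v' (x) w' the hyperdeterminant is
    ([u, u'] [v, v'] [w, w'])^2, while a slice at the double root gives rank
    at most 3. *)
Require Import Defs.
From HB Require Import structures.
From mathcomp Require Import all_boot all_order all_algebra.
From mathcomp Require Import mpoly complex reals.
From mathcomp Require Import ring.

Set Implicit Arguments.
Unset Strict Implicit.
Unset Printing Implicit Defensive.

Import GRing.Theory.
Local Open Scope ring_scope.

(** * Two-element index type and 2 x 2 determinants *)

Lemma ord2P (P : 'I_2 -> Prop) : P 0 -> P 1 -> forall i, P i.
Proof.
by move=> P0 P1 [[|[|i]] lti] //; [have -> : Ordinal lti = 0 by exact: val_inj
  | have -> : Ordinal lti = 1 by exact: val_inj].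
Qed.

Lemma sum_ord2 (V : nmodType) (F : 'I_2 -> V) : \sum_i F i = F 0 + F 1.
Proof.
by rewrite big_ord_recl big_ord1; congr (_ + F _); apply: val_inj.
Qed.

Lemma det_mx2 (S : comNzRingType) (B : 'M[S]_2) :
  \det B = B 0 0 * B 1 1 - B 0 1 * B 1 0.
Proof.
rewrite (expand_det_row _ 0) sum_ord2 /cofactor !det_mx11 !mxE /=.
have -> : lift 0 0 = 1 :> 'I_2 by apply: val_inj.
have -> : lift 1 0 = 0 :> 'I_2 by apply: val_inj.
by rewrite /= addn0 expr0 expr1; ring.
Qed.

(** * Binary quadratic forms: zeros, discriminant and degeneracy *)

Section BinaryQuadraticForms.
Variable K : fieldType.
Implicit Types (al be ga : K) (u v w : 'rV[K]_2) (f : {mpoly K[2]}).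

Definition row2 (x y : K) : 'rV[K]_2 := \row_i if i == 0 then x else y.

Lemma row2_0 x y : row2 x y 0 0 = x. Proof. by rewrite mxE. Qed.
Lemma row2_1 x y : row2 x y 0 1 = y. Proof. by rewrite mxE. Qed.
Definition row2E := (row2_0, row2_1).

Lemma rV2P u v : u 0 0 = v 0 0 -> u 0 1 = v 0 1 -> u = v.
Proof. by move=> e0 e1; apply/rowP; apply: ord2P. Qed.

Lemma rV2_neq0 v : (v != 0) = (v 0 0 != 0) || (v 0 1 != 0).
Proof.
apply/idP/idP => [|/orP[]]; last 2 first.
- by apply: contraNneq => ->; rewrite mxE.
- by apply: contraNneq => ->; rewrite mxE.
apply: contraNT; rewrite negb_or !negbK => /andP[/eqP v0 /eqP v1].
by apply/eqP/rV2P; rewrite mxE.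
Qed.

(** The determinant with rows u and v. For a point v it is, as a function of u, a linear form whose
    only zero in P^1 is v. *)
Definition bracket u v : K := u 0 0 * v 0 1 - u 0 1 * v 0 0.

Lemma bracket_eq0P u v : point u -> point v ->
  bracket u v = 0 <-> same_point u v.
Proof.
rewrite /point /bracket => u0 v0; split; last first.
  by case=> c c0 ->; rewrite !mxE; ring.
move/eqP; rewrite subr_eq0 => /eqP e.
(* The scalar is the quotient of the coordinates at a position where v is nonzero. *)
have [v00|v00] := eqVneq (v 0 0) 0.
  have v01 : v 0 1 != 0 by move: v0; rewrite rV2_neq0 v00 eqxx.
  have u00 : u 0 0 = 0.
    by apply/eqP; rewrite -(inj_eq (mulIf v01)) e v00 mulr0 mul0r.
  have u01 : u 0 1 != 0 by move: u0; rewrite rV2_neq0 u00 eqxx.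
  exists (u 0 1 / v 0 1); first by rewrite mulf_neq0 ?invr_neq0.
  by apply: rV2P; rewrite !mxE ?v00 ?u00 ?mulr0 ?mulfVK.
have eu1 : u 0 1 = u 0 0 / v 0 0 * v 0 1.
  by apply: (mulIf v00); rewrite -e; field.
have u00 : u 0 0 != 0.
  apply: contraTneq u0 => u00; rewrite rV2_neq0 eu1 u00 !mul0r.
  by rewrite eqxx.
exists (u 0 0 / v 0 0); first by rewrite mulf_neq0 ?invr_neq0.
by apply: rV2P; rewrite !mxE ?mulfVK.
Qed.

Lemma mderivXU n (S : nzRingType) (i j : 'I_n) :
  ('X_i : {mpoly S[n]})^`M(j) = (i == j)%:R%:MP.
Proof.
rewrite mderivX mnm1E; case: eqP => [->|_]; last by rewrite scale0r mpolyC0.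
rewrite scale1r (_ : _ - _ = 0)%MM ?mpolyX0 //.
by apply/mnmP => l; rewrite mnmBE mnm0E subnn.
Qed.

Definition bquad al be ga : {mpoly K[2]} :=
  al *: 'X_0 ^+ 2 + be *: ('X_0 * 'X_1) + ga *: 'X_1 ^+ 2.

Definition disc al be ga : K := be ^+ 2 - 4 * al * ga.

Lemma bquad_eval al be ga v : (bquad al be ga).@[v 0] =
  al * v 0 0 ^+ 2 + be * (v 0 0 * v 0 1) + ga * v 0 1 ^+ 2.
Proof. by rewrite !(mevalD, mevalZ, expr2, mevalM, mevalXU). Qed.

Lemma bquad_deriv0 al be ga v : (bquad al be ga)^`M(0).@[v 0] =
  2 * al * v 0 0 + be * v 0 1.
Proof.
rewrite !(mderivD, mderivZ, expr2, mderivM, mderivXU) /= ?mpolyC0 ?mpolyC1.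
by rewrite !(mevalD, mevalZ, mevalM, mevalXU, meval1, meval0); ring.
Qed.

Lemma bquad_deriv1 al be ga v : (bquad al be ga)^`M(1).@[v 0] =
  be * v 0 0 + 2 * ga * v 0 1.
Proof.
rewrite !(mderivD, mderivZ, expr2, mderivM, mderivXU) /= ?mpolyC0 ?mpolyC1.
by rewrite !(mevalD, mevalZ, mevalM, mevalXU, meval1, meval0); ring.
Qed.

Lemma bquad_eq0P al be ga :
  bquad al be ga = 0 <-> [/\ al = 0, be = 0 & ga = 0].
Proof.
split=> [f0|[-> -> ->]]; last by rewrite /bquad !scale0r !addr0.
(* The values at (1, 0), (0, 1) and (1, 1) determine the three coefficients. *)
have ev v := bquad_eval al be ga v; rewrite f0 in ev.
have al0 : al = 0 by move: (ev (row2 1 0)); rewrite meval0 !row2E => ->; ring.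
have ga0 : ga = 0 by move: (ev (row2 0 1)); rewrite meval0 !row2E => ->; ring.
split=> //; move: (ev (row2 1 1)); rewrite meval0 !row2E al0 ga0 => ->; ring.
Qed.

(** The partial derivatives at v form a linear system in v whose determinant is -[disc]. By Cramer's
    rule [disc] annihilates both coordinates of v, one of which is nonzero. *)
Lemma degenerate_disc al be ga :
  degenerate (bquad al be ga) -> disc al be ga = 0.
Proof.
case=> v []; rewrite /point rV2_neq0 /disc => v0 _ dv.
have := dv 0; have := dv 1; rewrite /zero_at bquad_deriv0 bquad_deriv1 => e1 e0.
have h0 : (be ^+ 2 - 4 * al * ga) * v 0 0 =
  be * (be * v 0 0 + 2 * ga * v 0 1) - 2 * ga * (2 * al * v 0 0 + be * v 0 1).
  by ring.
have h1 : (be ^+ 2 - 4 * al * ga) * v 0 1 =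
  be * (2 * al * v 0 0 + be * v 0 1) - 2 * al * (be * v 0 0 + 2 * ga * v 0 1).
  by ring.
rewrite e0 e1 !mulr0 subr0 in h0 h1.
by case/orP: v0 => vn0; apply: (mulIf vn0); rewrite mul0r.
Qed.

(** By the Leibniz rule the form and its partial derivatives all remain divisible by the linear form
    vanishing at v. *)
Lemma double_root_degenerate f : double_root f -> degenerate f.
Proof.
case=> v v0 [g ->]; exists v; split=> // [|i]; rewrite /zero_at.
  by rewrite mevalM expr2 !mevalM mevalB !mevalZ !mevalXU; ring.
by rewrite !(mderivM, expr2, mevalM, mevalD, mevalN, mevalZ, mevalXU); ring.
Qed.

(** Completing the square gives 4 al f = (2 al x_1 + be x_2)^2, with double root (-be, 2 al). If al
    = 0, then be = 0 and f = ga x_2^2, with double root (1, 0). *)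
Lemma double_root_bquad al be ga : (2 : K) != 0 ->
  disc al be ga = 0 -> double_root (bquad al be ga).
Proof.
rewrite /disc => two0 d0.
have [al0|al0] := eqVneq al 0.
  have be0 : be = 0.
    by apply/eqP; rewrite -sqrf_eq0 -d0 al0; apply/eqP; ring.
  exists (row2 1 0); first by rewrite /point rV2_neq0 row2E oner_eq0.
  exists (ga%:MP); rewrite /bquad al0 be0 !row2E !scale0r scale1r.
  by rewrite -!mul_mpolyC; ring.
exists (row2 (- be) (2 * al)).
  by rewrite /point rV2_neq0 !row2E mulf_neq0 ?orbT.
have al4 : 4 * al != 0.
  by rewrite (_ : 4 = 2 * 2) ?mulf_neq0 //; ring.
exists ((4 * al)^-1)%:MP; rewrite /bquad !row2E -!mul_mpolyC.
transitivity (((4 * al)^-1 * (2 * al) ^+ 2)%:MP * 'X_0 ^+ 2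
  + ((4 * al)^-1 * (2 * (2 * al) * be))%:MP * ('X_0 * 'X_1)
  + ((4 * al)^-1 * be ^+ 2)%:MP * 'X_1 ^+ 2 : {mpoly K[2]}); last by ring.
congr (_%:MP * _ + _%:MP * _ + _%:MP * _);
  apply: (mulfI al4); rewrite [RHS]mulrA divff // mul1r; try by ring.
(* The coefficient of ['X_1 ^+ 2] is where the discriminant enters: be^2 = 4 al ga. *)
by apply/eqP; rewrite eq_sym -subr_eq0 d0.
Qed.

(** With B the polar form of f, disc [u, v]^2 = B(u, v)^2 - 4 f(u) f(v). If disc = 0 and u, v are
    zeros, then B(u, v) = 0, so f(u + v) = f(u) + f(v) + B(u, v) = 0: a third zero, different from u
    and v because its brackets with them are -[u, v] and [u, v]. *)
Lemma two_distinct_zeros_disc al be ga :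
  two_distinct_zeros (bquad al be ga) -> disc al be ga != 0.
Proof.
case=> u [v [u0 v0 uv zP]].
have fu : (bquad al be ga).@[u 0] = 0.
  by apply/(zP u u0); left; exists 1; rewrite ?oner_neq0 ?scale1r.
have fv : (bquad al be ga).@[v 0] = 0.
  by apply/(zP v v0); right; exists 1; rewrite ?oner_neq0 ?scale1r.
rewrite !bquad_eval in fu fv.
have buv : bracket u v != 0 by apply/eqP => /bracket_eq0P-/(_ u0 v0).
have b_uvu : bracket (u + v) u = - bracket u v by rewrite /bracket !mxE; ring.
have b_uvv : bracket (u + v) v = bracket u v by rewrite /bracket !mxE; ring.
have w0 : point (u + v).
  apply: contraNneq buv => uv0; rewrite -b_uvv uv0 /bracket !mxE.
  by apply/eqP; ring.
apply: contraNneq buv => d0.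
have polar : disc al be ga * bracket u v ^+ 2 =
    (2 * al * u 0 0 * v 0 0 + be * (u 0 0 * v 0 1 + u 0 1 * v 0 0)
      + 2 * ga * u 0 1 * v 0 1) ^+ 2
    - 4 * (al * u 0 0 ^+ 2 + be * (u 0 0 * u 0 1) + ga * u 0 1 ^+ 2)
        * (al * v 0 0 ^+ 2 + be * (v 0 0 * v 0 1) + ga * v 0 1 ^+ 2).
  by rewrite /disc /bracket; ring.
move: polar; rewrite d0 fu mulr0 !mul0r subr0 => /esym/eqP.
rewrite sqrf_eq0 => /eqP polar0.
have /(zP _ w0) : zero_at (bquad al be ga) (u + v).
  rewrite /zero_at bquad_eval !mxE -[RHS](addr0 0) -{1}fu -[RHS]addr0.
  by rewrite -{1}fv -polar0; ring.
case=> /bracket_eq0P; [move=> /(_ w0 u0)|move=> /(_ w0 v0)].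
  by rewrite b_uvu => /eqP; rewrite oppr_eq0.
by rewrite b_uvv => ->.
Qed.

(** A product of two non-proportional linear forms has exactly their two zeros. The scalar c leaves
    room for clearing denominators. *)
Lemma bquad_split_zeros al be ga u v (c : K) : c != 0 -> bracket u v != 0 ->
  (forall w, c * (bquad al be ga).@[w 0] = bracket w u * bracket w v) ->
  two_distinct_zeros (bquad al be ga).
Proof.
move=> c0 buv fE.
have u0 : point u.
  by apply: contraNneq buv => ->; rewrite /bracket !mxE !mul0r subr0.
have v0 : point v.
  by apply: contraNneq buv => ->; rewrite /bracket !mxE !mulr0 subr0.
exists u, v; split=> //.
  by move/(bracket_eq0P u0 v0)/eqP; apply/negP.
move=> w w0; rewrite /zero_at -(bracket_eq0P w0 u0) -(bracket_eq0P w0 v0); split.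
  move=> fw; move: (fE w); rewrite fw mulr0 => /esym/eqP.
  by rewrite mulf_eq0 => /orP[] /eqP; [left|right].
move=> h; apply: (mulfI c0); rewrite fE mulr0.
by case: h => ->; rewrite ?mul0r ?mulr0.
Qed.

(** The quadratic formula gives the zeros (-be + s, 2 al) and (-be - s, 2 al). If al = 0, the form
    is x_2 (be x_1 + ga x_2), with zeros (1, 0) and (-ga, be). *)
Lemma disc_two_distinct_zeros al be ga (s : K) : (2 : K) != 0 -> s != 0 ->
  s ^+ 2 = disc al be ga -> two_distinct_zeros (bquad al be ga).
Proof.
rewrite /disc => two0 s0 s2.
have [al0|al0] := eqVneq al 0.
  have be0 : be != 0.
    apply: contraNneq s0 => be0; rewrite -sqrf_eq0 s2 al0 be0.
    by apply/eqP; ring.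
  apply: (@bquad_split_zeros _ _ _ (row2 1 0) (row2 (- ga) be) (-1)).
  - by rewrite oppr_eq0 oner_eq0.
  - by rewrite /bracket !row2E mul1r mul0r subr0.
  - by move=> w; rewrite bquad_eval /bracket !row2E al0; ring.
have four0 : (4 : K) != 0 by rewrite (_ : 4 = 2 * 2) ?mulf_neq0 //; ring.
apply: (@bquad_split_zeros _ _ _ (row2 (- be + s) (2 * al))
  (row2 (- be - s) (2 * al)) (4 * al)).
- by rewrite mulf_neq0.
- suff -> : bracket (row2 (- be + s) (2 * al)) (row2 (- be - s) (2 * al))
    = 4 * al * s by rewrite !mulf_neq0.
  by rewrite /bracket !row2E; ring.
- move=> w; rewrite bquad_eval /bracket !row2E.
  transitivity ((2 * al * w 0 0 + be * w 0 1) ^+ 2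
    - (be ^+ 2 - 4 * al * ga) * w 0 1 ^+ 2); first by ring.
  by rewrite -s2; ring.
Qed.

End BinaryQuadraticForms.

(** * Determinants of the three slicings and the hyperdeterminant *)

Section Pencils.
Variable K : fieldType.
Implicit Types a : hypermatrix222 K.

(** Permutations of the three directions, so that a statement about L and x also serves M with y and
    N with z. *)
Definition swapxy a : hypermatrix222 K := fun j i k => a i j k.
Definition rotz a : hypermatrix222 K := fun k i j => a i j k.

(** The coefficients of det L: the determinants of the two x-slices are the extreme ones, and the
    polarized determinant of the slices is the mixed one. *)
Definition pencil0 a := a 0 0 0 * a 0 1 1 - a 0 0 1 * a 0 1 0.
Definition pencil1 a := a 0 0 0 * a 1 1 1 + a 1 0 0 * a 0 1 1
  - a 0 0 1 * a 1 1 0 - a 1 0 1 * a 0 1 0.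
Definition pencil2 a := a 1 0 0 * a 1 1 1 - a 1 0 1 * a 1 1 0.

Lemma det_matL a :
  \det (matL a) = bquad (pencil0 a) (pencil1 a) (pencil2 a).
Proof.
rewrite det_mx2 !mxE !sum_ord2 /bquad /pencil0 /pencil1 /pencil2.
by rewrite -!mul_mpolyC; ring.
Qed.

Lemma det_matM a : \det (matM a) = \det (matL (swapxy a)).
Proof. by []. Qed.

Lemma det_matN a : \det (matN a) = \det (matL (rotz a)).
Proof. by []. Qed.

Lemma det_matM_swapxy a : \det (matM (swapxy a)) = \det (matL a).
Proof. by []. Qed.

Lemma det_matN_swapxy a : \det (matN (swapxy a)) = \det (matN a).
Proof.
by rewrite -[RHS]det_tr; congr (\det _); apply/matrixP=> i j; rewrite !mxE.
Qed.

Lemma det_matM_rotz a : \det (matM (rotz a)) = \det (matL a).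
Proof.
by rewrite -[RHS]det_tr; congr (\det _); apply/matrixP=> i j; rewrite !mxE.
Qed.

Lemma det_matN_rotz a : \det (matN (rotz a)) = \det (matM a).
Proof.
by rewrite -[RHS]det_tr; congr (\det _); apply/matrixP=> i j; rewrite !mxE.
Qed.

Lemma hyperdet_swapxy a : hyperdet (swapxy a) = hyperdet a.
Proof. by rewrite /hyperdet /swapxy; ring. Qed.

Lemma hyperdet_rotz a : hyperdet (rotz a) = hyperdet a.
Proof. by rewrite /hyperdet /rotz; ring. Qed.

(** Cayley's hyperdeterminant as the discriminant of det L. Its invariance under [swapxy] and [rotz]
    gives the same for det M and det N. *)
Lemma disc_pencil a :
  disc (pencil0 a) (pencil1 a) (pencil2 a) = hyperdet a.
Proof. by rewrite /disc /pencil0 /pencil1 /pencil2 /hyperdet; ring. Qed.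

Lemma det_matL_eq0P a : \det (matL a) = 0 <->
  [/\ pencil0 a = 0, pencil1 a = 0 & pencil2 a = 0].
Proof. by rewrite det_matL bquad_eq0P. Qed.

Lemma det_matL_eq0_hyperdet a : \det (matL a) = 0 -> hyperdet a = 0.
Proof.
by move/det_matL_eq0P => [p0 p1 p2]; rewrite -disc_pencil /disc p0 p1; ring.
Qed.

Lemma two_distinct_zeros_hyperdet a :
  two_distinct_zeros (\det (matL a)) -> hyperdet a != 0.
Proof. by rewrite det_matL -disc_pencil; apply: two_distinct_zeros_disc. Qed.

Lemma double_root_hyperdet a : double_root (\det (matL a)) -> hyperdet a = 0.
Proof.
move/double_root_degenerate; rewrite det_matL -disc_pencil.
exact: degenerate_disc.
Qed.

Lemma hyperdet_double_root a : (2 : K) != 0 ->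
  hyperdet a = 0 -> double_root (\det (matL a)).
Proof. by move=> two0; rewrite -disc_pencil det_matL; apply: double_root_bquad. Qed.

Lemma hyperdet_two_distinct_zeros a (s : K) : (2 : K) != 0 ->
  hyperdet a != 0 -> s ^+ 2 = hyperdet a -> two_distinct_zeros (\det (matL a)).
Proof.
rewrite -disc_pencil det_matL => two0 d0 s2.
by apply: (disc_two_distinct_zeros two0 _ s2); rewrite -sqrf_eq0 s2.
Qed.

(** The 2 x 4 flattening along x has rank at most one: A is the tensor product of a vector c and a
    matrix b. *)
Definition separable a := exists (c : 'I_2 -> K) (b : 'I_2 -> 'I_2 -> K),
  forall i j k, a i j k = c i * b j k.

(** Row i of M, and of N, is c_i times a row that does not depend on i, so both matrices have
    proportional rows. *)
Lemma separable_dets a : separable a ->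
  \det (matM a) = 0 /\ \det (matN a) = 0.
Proof.
case=> c [b ab]; rewrite det_matM det_matN !det_matL_eq0P.
by split; split; rewrite /pencil0 /pencil1 /pencil2 /swapxy /rotz !ab; ring.
Qed.

Lemma minors_separable a :
  (forall j k j' k', a 0 j k * a 1 j' k' = a 0 j' k' * a 1 j k) -> separable a.
Proof.
move=> minor0.
(* A nonzero entry of the first slice serves as pivot. If there is none, that slice is zero and c =
   (0, 1). *)
have [/forallP a00|] := boolP [forall j, forall k, a 0 j k == 0].
  exists (fun i => (i == 1)%:R), (fun j k => a 1 j k).
  apply: ord2P => j k; last by rewrite mul1r.
  by rewrite mul0r; move/forallP: (a00 j) => /(_ k)/eqP.
rewrite negb_forall => /existsP[j0]; rewrite negb_forall => /existsP[k0 pivot].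
exists (fun i => a i j0 k0 / a 0 j0 k0), (fun j k => a 0 j k).
apply: ord2P => j k; first by rewrite divff // mul1r.
apply: (mulfI pivot); rewrite minor0 mulrA mulrC.
by rewrite [a 1 j0 k0 / _]mulrC mulrA divff ?mul1r // mulrC.
Qed.

(** Of the six 2 x 2 minors of the flattening along x, four are, up to sign, the extreme
    coefficients of det M and det N. The other two come from the mixed coefficients. *)
Lemma dets_separable a : (2 : K) != 0 ->
  \det (matM a) = 0 -> \det (matN a) = 0 -> separable a.
Proof.
move=> two0; rewrite det_matM det_matN !det_matL_eq0P.
rewrite /pencil0 /pencil1 /pencil2 /swapxy /rotz => -[m0 m1 m2] [n0 n1 n2].
(* The mixed coefficients of det M and det N are the sum and the difference of
   the two diagonal minors, whence the factor 2. *)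
have d1 : a 0 0 0 * a 1 1 1 = a 0 1 1 * a 1 0 0.
  apply/eqP; rewrite -subr_eq0 -(inj_eq (mulfI two0)) mulr0; apply/eqP.
  by rewrite -[RHS](addr0 0) -{1}m1 -n1; ring.
have d2 : a 0 0 1 * a 1 1 0 = a 0 1 0 * a 1 0 1.
  apply/eqP; rewrite -subr_eq0 -(inj_eq (mulfI two0)) mulr0; apply/eqP.
  by rewrite -[RHS](subr0 0) -{1}n1 -m1; ring.
move/eqP: m0; rewrite subr_eq0 => /eqP m0.
move/eqP: m2; rewrite subr_eq0 => /eqP m2.
move/eqP: n0; rewrite subr_eq0 => /eqP n0.
move/eqP: n2; rewrite subr_eq0 => /eqP n2.
apply: minors_separable; apply: ord2P; apply: ord2P; apply: ord2P; apply: ord2P.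
all: rewrite // ?m0 ?m2 ?n0 ?n2 ?d1 ?d2; try by ring.
Qed.

Lemma det_matL_eq0_or a : \det (matL a) = 0 ->
  \det (matM a) = 0 \/ \det (matN a) = 0.
Proof.
move=> dL0; have det0 := det_matL_eq0_hyperdet dL0.
(* Once the extreme coefficients vanish, the discriminant is the square of the mixed one. *)
have zeroP b : hyperdet b = 0 -> pencil0 b = 0 -> pencil2 b = 0 ->
    \det (matL b) = 0.
  rewrite -disc_pencil /disc => /eqP + p0 p2; rewrite p0 p2 mulr0 subr0 sqrf_eq0.
  by move/eqP=> p1; apply/det_matL_eq0P.
move/det_matL_eq0P: dL0 => [p0 p1 p2].
(* The right-hand side is -det L at (x1, -x0). For x0, x1 the entries of A at position (j, k) of the
   two slices, L at this point has entry 0 at (j, k), so its determinant is up to sign the product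
   of the two adjacent entries. These are, up to sign, the coefficients of y_j^2 in det M and of
   z_k^2 in det N. *)
have prod0 x0 x1 m n :
    m * n = x0 * x1 * pencil1 a - x1 ^+ 2 * pencil0 a - x0 ^+ 2 * pencil2 a ->
    m != 0 -> n = 0.
  by rewrite p0 p1 p2 => mn m0; apply: (mulfI m0); rewrite mn; ring.
have N0 m : m != 0 -> (m = pencil0 (swapxy a)) \/ (m = pencil2 (swapxy a)) ->
    \det (matN a) = 0.
  move=> m0 mE; rewrite det_matN; apply: zeroP; first by rewrite hyperdet_rotz.
    case: mE => mE; [apply: (@prod0 (a 0 0 0) (a 1 0 0) m) => //
                    |apply: (@prod0 (a 0 1 0) (a 1 1 0) m) => //].
      by rewrite mE /pencil0 /pencil1 /pencil2 /swapxy /rotz; ring.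
    by rewrite mE /pencil0 /pencil1 /pencil2 /swapxy /rotz; ring.
  case: mE => mE; [apply: (@prod0 (a 0 0 1) (a 1 0 1) m) => //
                  |apply: (@prod0 (a 0 1 1) (a 1 1 1) m) => //].
    by rewrite mE /pencil0 /pencil1 /pencil2 /swapxy /rotz; ring.
  by rewrite mE /pencil0 /pencil1 /pencil2 /swapxy /rotz; ring.
have [m0|m0] := eqVneq (pencil0 (swapxy a)) 0; last by right; apply: N0 m0 _; left.
have [m2|m2] := eqVneq (pencil2 (swapxy a)) 0; last by right; apply: N0 m2 _; right.
by left; rewrite det_matM; apply: zeroP => //; rewrite hyperdet_swapxy.
Qed.

End Pencils.

(** * Sums of decomposable tensors *)

Section TensorRank.
Variable K : fieldType.
Implicit Types a b : hypermatrix222 K.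

Lemma sum_of_decomposables_swapxy a r :
  sum_of_decomposables a r -> sum_of_decomposables (swapxy a) r.
Proof.
case=> u [v [w auvw]]; exists v, u, w => j i k; rewrite /swapxy auvw.
by apply: eq_bigr => s _; ring.
Qed.

Lemma sum_of_decomposables_rotz a r :
  sum_of_decomposables a r -> sum_of_decomposables (rotz a) r.
Proof.
case=> u [v [w auvw]]; exists w, u, v => k i j; rewrite /rotz auvw.
by apply: eq_bigr => s _; ring.
Qed.

Lemma tensor_rank_swapxy a r : tensor_rank (swapxy a) r -> tensor_rank a r.
Proof.
case=> /sum_of_decomposables_swapxy ar rmin; split=> // s.
by move/sum_of_decomposables_swapxy/rmin.
Qed.

(** Since [rotz] has order three, two further rotations lead from [rotz a] back to [a]. *)
Lemma tensor_rank_rotz a r : tensor_rank (rotz a) r -> tensor_rank a r.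
Proof.
case=> /sum_of_decomposables_rotz/sum_of_decomposables_rotz ar rmin.
by split=> // s /sum_of_decomposables_rotz/rmin.
Qed.

Lemma sum_of_decomposables_add a b c r s :
  sum_of_decomposables a r -> sum_of_decomposables b s ->
  (forall i j k, c i j k = a i j k + b i j k) -> sum_of_decomposables c (r + s).
Proof.
move=> [u [v [w ar]]] [u' [v' [w' bs]]] cab.
pose glue (f : 'I_r -> 'rV[K]_2) (g : 'I_s -> 'rV[K]_2) (t : 'I_(r + s)) :=
  match split t with inl t => f t | inr t => g t end.
have glueL f g t : glue f g (lshift s t) = f t.
  by rewrite /glue (unsplitK (inl t)).
have glueR f g t : glue f g (rshift r t) = g t.
  by rewrite /glue (unsplitK (inr t)).
exists (glue u u'), (glue v v'), (glue w w') => i j k.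
rewrite cab ar bs big_split_ord /=.
by congr (_ + _); apply: eq_bigr => t _; rewrite ?glueL ?glueR.
Qed.

(** Decomposables may be zero, so a short sum can be padded. *)
Lemma sum_of_decomposables_leq a r s : (r <= s)%N ->
  sum_of_decomposables a r -> sum_of_decomposables a s.
Proof.
move=> /subnKC <- ar.
have zs : sum_of_decomposables (fun _ _ _ => 0 : K) (s - r).
  exists (fun=> 0), (fun=> 0), (fun=> 0) => i j k.
  by rewrite big1 // => t _; rewrite !mxE !mul0r.
by apply: sum_of_decomposables_add ar zs _ => i j k; rewrite addr0.
Qed.

Lemma decomposable1P a : sum_of_decomposables a 1 <->
  exists u v w : 'I_2 -> K, forall i j k, a i j k = u i * v j * w k.
Proof.
split=> [[u [v [w auvw]]]|[u [v [w auvw]]]].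
  by exists (u 0 0), (v 0 0), (w 0 0) => i j k; rewrite auvw big_ord1.
exists (fun=> \row_i u i), (fun=> \row_i v i), (fun=> \row_i w i) => i j k.
by rewrite big_ord1 !mxE auvw.
Qed.

Lemma decomposable1_separable a : sum_of_decomposables a 1 -> separable a.
Proof.
move/decomposable1P => [u [v [w auvw]]].
by exists u, (fun j k => v j * w k) => i j k; rewrite auvw mulrA.
Qed.

(** A decomposable tensor has rank at most one along y as well, which forces det L = 0. *)
Lemma decomposable1_det a : sum_of_decomposables a 1 -> \det (matL a) = 0.
Proof.
by move/sum_of_decomposables_swapxy/decomposable1_separable/separable_dets => [].
Qed.

(** For two summands, det L = [v, v'] [w, w'] (u.x) (u'.x) and det M = [u, u'] [w, w'] (v.y) (v'.y).
    The hyperdeterminant is the square of the product of the three brackets, so one of them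
    vanishes, and with it det L or det M. *)
Lemma decomposable2_det a : sum_of_decomposables a 2 -> hyperdet a = 0 ->
  \det (matL a) = 0 \/ \det (matM a) = 0.
Proof.
move=> [u [v [w auvw]]]; pose d (f : 'I_2 -> 'rV[K]_2) := bracket (f 0) (f 1).
have aE i j k : a i j k = u 0 0 i * v 0 0 j * w 0 0 k + u 1 0 i * v 1 0 j * w 1 0 k.
  by rewrite auvw sum_ord2.
have -> : hyperdet a = (d u * d v * d w) ^+ 2.
  by rewrite /hyperdet !aE /d /bracket; ring.
move/eqP; rewrite sqrf_eq0 mulf_eq0 => duvw.
have [dvw|dvw] := eqVneq (d v * d w) 0.
  left; apply/det_matL_eq0P; split.
  - transitivity (d v * d w * (u 0 0 0 * u 1 0 0));
      last by rewrite dvw !mul0r.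
    by rewrite /pencil0 !aE /d /bracket; ring.
  - transitivity (d v * d w * (u 0 0 0 * u 1 0 1 + u 0 0 1 * u 1 0 0));
      last by rewrite dvw !mul0r.
    by rewrite /pencil1 !aE /d /bracket; ring.
  - transitivity (d v * d w * (u 0 0 1 * u 1 0 1));
      last by rewrite dvw !mul0r.
    by rewrite /pencil2 !aE /d /bracket; ring.
right; have {duvw dvw} du : d u = 0.
  move: duvw dvw; rewrite -mulf_eq0 -mulrA mulf_eq0 => /orP[/eqP //|/eqP ->].
  by rewrite eqxx.
rewrite det_matM; apply/det_matL_eq0P; split.
- transitivity (d u * d w * (v 0 0 0 * v 1 0 0));
    last by rewrite du !mul0r.
  by rewrite /pencil0 /swapxy !aE /d /bracket; ring.
- transitivity (d u * d w * (v 0 0 0 * v 1 0 1 + v 0 0 1 * v 1 0 0));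
    last by rewrite du !mul0r.
  by rewrite /pencil1 /swapxy !aE /d /bracket; ring.
- transitivity (d u * d w * (v 0 0 1 * v 1 0 1));
    last by rewrite du !mul0r.
  by rewrite /pencil2 /swapxy !aE /d /bracket; ring.
Qed.

Lemma rank1_mx2 (b : 'I_2 -> 'I_2 -> K) : b 0 0 * b 1 1 = b 0 1 * b 1 0 ->
  exists v w, forall j k, b j k = v j * w k.
Proof.
move=> det0.
(* The matrix is viewed as a hypermatrix constant in its last index, which reduces its factorization
   to that of flattenings. *)
have : separable (fun j k (_ : 'I_2) => b j k).
  apply: minors_separable; apply: ord2P => k; apply: ord2P => k'; try by ring.
    by [].
  by rewrite -det0.
by case=> v [w bvw]; exists v, (fun k => w k 0) => j k; rewrite -bvw.
Qed.

Lemma slice_decomposable1 (c : 'I_2 -> K) (b : 'I_2 -> 'I_2 -> K) :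
  b 0 0 * b 1 1 = b 0 1 * b 1 0 ->
  sum_of_decomposables (fun i j k => c i * b j k) 1.
Proof.
move/rank1_mx2 => [v [w bvw]]; apply/decomposable1P; exists c, v, w => i j k.
by rewrite bvw mulrA.
Qed.

(** The matrix b is the sum over its two rows of unit vector times row. *)
Lemma slice_decomposable2 (c : 'I_2 -> K) (b : 'I_2 -> 'I_2 -> K) :
  sum_of_decomposables (fun i j k => c i * b j k) 2.
Proof.
pose e l : 'I_2 -> K := fun j : 'I_2 => (j == l)%:R.
have dec l : sum_of_decomposables (fun i j k => c i * e l j * b l k) 1.
  by apply/decomposable1P; exists c, (e l), (b l).
have [e00 e01 e10 e11] : [/\ e 0 0 = 1, e 0 1 = 0, e 1 0 = 0 & e 1 1 = 1] by [].
apply: (sum_of_decomposables_add (dec 0) (dec 1)) => i.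
by apply: ord2P => k; rewrite ?e00 ?e01 ?e10 ?e11; ring.
Qed.

(** The matrix L evaluated at p; it is singular exactly at the zeros of det L. *)
Definition slice a (p : 'rV[K]_2) j k := p 0 0 * a 0 j k + p 0 1 * a 1 j k.

Lemma slice_singular a p : zero_at (\det (matL a)) p ->
  slice a p 0 0 * slice a p 1 1 = slice a p 0 1 * slice a p 1 0.
Proof.
rewrite /zero_at det_matL bquad_eval => p0; apply/eqP; rewrite -subr_eq0 -p0.
by rewrite /slice /pencil0 /pencil1 /pencil2; apply/eqP; ring.
Qed.

(* The slices at two independent points p and q span the pencil; the
   coefficients of a in terms of them form the basis dual to (p, q). *)
Lemma slice_basis a p q : bracket p q != 0 -> forall i j k, a i j k =
  row2 (q 0 1) (- q 0 0) 0 i / bracket p q * slice a p j k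
  + row2 (- p 0 1) (p 0 0) 0 i / bracket p q * slice a q j k.
Proof.
by rewrite /bracket => pq; apply: ord2P => j k; rewrite !row2E /slice; field.
Qed.

Lemma two_distinct_zeros_decomposable2 a :
  two_distinct_zeros (\det (matL a)) -> sum_of_decomposables a 2.
Proof.
case=> p [q [p0 q0 pq zP]].
have {pq} pq : bracket p q != 0 by apply/eqP => /bracket_eq0P-/(_ p0 q0).
have zp : zero_at (\det (matL a)) p.
  by apply/(zP p p0); left; exists 1; rewrite ?oner_neq0 ?scale1r.
have zq : zero_at (\det (matL a)) q.
  by apply/(zP q q0); right; exists 1; rewrite ?oner_neq0 ?scale1r.
exact: (sum_of_decomposables_add (slice_decomposable1 _ (slice_singular zp))
  (slice_decomposable1 _ (slice_singular zq)) (slice_basis a pq)).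
Qed.

Lemma double_root_decomposable3 a :
  double_root (\det (matL a)) -> sum_of_decomposables a 3.
Proof.
case/double_root_degenerate => p [p0 zp _].
have [q pq] : exists q, bracket p q != 0.
  move: p0; rewrite /point rV2_neq0 => /orP[p00|p01].
    by exists (row2 0 1); rewrite /bracket !row2E mulr1 mulr0 subr0.
  by exists (row2 1 0); rewrite /bracket !row2E mulr1 mulr0 sub0r oppr_eq0.
(* The singular slice at p contributes one term, the arbitrary slice at q two. *)
exact: (sum_of_decomposables_add (slice_decomposable1 _ (slice_singular zp))
  (slice_decomposable2 _ _) (slice_basis a pq)).
Qed.

End TensorRank.

(** * Essential format in coordinates *)

Section EssentialFormat.
Variable K : fieldType.
Implicit Types a : hypermatrix222 K.

Lemma exchange_sum3 (V : nmodType) (I J1 J2 J3 : finType)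
    (F : I -> J1 -> J2 -> J3 -> V) :
  \sum_i \sum_x \sum_y \sum_z F i x y z = \sum_x \sum_y \sum_z \sum_i F i x y z.
Proof.
rewrite exchange_big; apply: eq_bigr => x _.
by rewrite exchange_big; apply: eq_bigr => y _; rewrite exchange_big.
Qed.

Lemma mul_sum3 (S : comNzRingType) (I J L : finType) (c : S) (F : I -> S)
    (G : J -> S) (H : L -> S) :
  c * ((\sum_i F i) * (\sum_j G j) * (\sum_l H l)) =
  \sum_i \sum_j \sum_l c * (F i * G j * H l).
Proof.
rewrite big_distrlr mulr_suml mulr_sumr; apply: eq_bigr => i _ /=.
rewrite mulr_suml mulr_sumr; apply: eq_bigr => j _.
by rewrite mulr_sumr mulr_sumr.
Qed.

(** A Tucker decomposition with core t: the coordinate form of [format_achieved], where t holds the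
    coefficients of Q. *)
Definition tucker a p q r :=
  exists (cx : 'I_p -> 'I_2 -> K) (cy : 'I_q -> 'I_2 -> K)
    (cz : 'I_r -> 'I_2 -> K) (t : 'I_p -> 'I_q -> 'I_r -> K),
  forall i j k, a i j k =
    \sum_l \sum_m \sum_n t l m n * (cx l i * cy m j * cz n k).

Lemma tucker_swapxy a p q r : tucker a p q r -> tucker (swapxy a) q p r.
Proof.
case=> cx [cy [cz [t at_]]]; exists cy, cx, cz, (fun m l n => t l m n) => j i k.
rewrite /swapxy at_ exchange_big; apply: eq_bigr => m _; apply: eq_bigr => l _.
by apply: eq_bigr => n _; rewrite (mulrC (cx l i)).
Qed.

Lemma tucker_rotz a p q r : tucker a p q r -> tucker (rotz a) r p q.
Proof.
case=> cx [cy [cz [t at_]]]; exists cz, cx, cy, (fun n l m => t l m n) => k i j.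
rewrite /rotz at_ [RHS]exchange_big; apply: eq_bigr => l _.
rewrite [RHS]exchange_big; apply: eq_bigr => m _; apply: eq_bigr => n _.
by ring.
Qed.

Lemma tucker_separable a p q r : (p <= 1)%N -> tucker a p q r -> separable a.
Proof.
move=> p1 [cx [cy [cz [t at_]]]].
case: p p1 cx t at_ => [|[|//]] _ cx t at_.
  by exists (fun=> 0), (fun _ _ => 0) => i j k; rewrite at_ big_ord0 mul0r.
exists (cx 0), (fun j k => \sum_m \sum_n t 0 m n * (cy m j * cz n k)) => i j k.
rewrite at_ big_ord1 mulr_sumr; apply: eq_bigr => m _; rewrite mulr_sumr.
by apply: eq_bigr => n _; ring.
Qed.

Lemma tucker_gt0 a p q r : (exists i j k, a i j k != 0) -> tucker a p q r ->
  (0 < p)%N.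
Proof.
move=> [i [j [k aijk]]] [cx [cy [cz [t at_]]]]; case: p cx t at_ => // cx t at_.
by rewrite at_ big_ord0 eqxx in aijk.
Qed.

Section Blocks.
Variables (p q r : nat) (T : Type).
Variables (x : 'I_p -> T) (y : 'I_q -> T) (z : 'I_r -> T).

Lemma tnth_block_x l : tnth (block_tuple x y z) (idx_x q r l) = x l.
Proof. by rewrite tnth_mktuple (unsplitK (inl _)) (unsplitK (inl _)). Qed.

Lemma tnth_block_y m : tnth (block_tuple x y z) (idx_y p r m) = y m.
Proof. by rewrite tnth_mktuple (unsplitK (inl _)) (unsplitK (inr _)). Qed.

Lemma tnth_block_z n : tnth (block_tuple x y z) (idx_z p q n) = z n.
Proof. by rewrite tnth_mktuple (unsplitK (inr _)). Qed.

End Blocks.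

Definition tnth_block := (tnth_block_x, tnth_block_y, tnth_block_z).

(** Natural exponents of sum 1 are a single 1 and zeros otherwise, so the monomial is one variable
    and can be written as a linear expression. *)
Lemma sum1_prod_exp n (e : 'I_n -> nat) (x : 'I_n -> K) : (\sum_l e l)%N = 1%N ->
  \prod_l x l ^+ e l = \sum_l x l * (e l)%:R.
Proof.
move=> e1.
have /existsP[l0 el0] : [exists l, e l != 0%N].
  rewrite -negb_forall; apply: contra_eqN e1 => /forallP e0.
  by rewrite big1 // => l _; apply/eqP.
have := e1; rewrite (bigD1 l0) //= => e1'.
have el01 : e l0 = 1%N.
  by move: el0 e1'; case: (e l0) => // [[|m]].
have e0 l : l != l0 -> e l = 0%N.
  move=> ll0; move: e1'; rewrite el01 => /eqP; rewrite eqSS sum_nat_eq0.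
  by move/forall_inP/(_ l ll0)/eqP.
rewrite (bigD1 l0) //= big1 => [|l /e0 ->]; last by rewrite expr0.
rewrite [RHS](bigD1 l0) //= [X in _ = _ + X]big1 => [|l /e0 ->];
  last by rewrite mulr0.
by rewrite el01 expr1 !mulr1 addr0.
Qed.

Lemma trihomogeneous_meval p q r (Q : {mpoly K[p + q + r]}) :
  trihomogeneous 1 1 1 Q ->
  exists t : 'I_p -> 'I_q -> 'I_r -> K, forall x y z,
    Q.@[tnth (block_tuple x y z)] = \sum_l \sum_m \sum_n t l m n * (x l * y m * z n).
Proof.
(* In a monomial of tridegree (1, 1, 1) all exponents are 0 or 1, so the product of three exponents
   selects the monomial in the variables l, m, n. *)
move=> hQ; exists (fun l m n => \sum_(e <- msupp Q) Q@_e *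
  ((e (idx_x q r l))%:R * (e (idx_y p r m))%:R * (e (idx_z p q n))%:R)) => x y z.
rewrite mevalE.
transitivity (\sum_(e <- msupp Q) \sum_l \sum_m \sum_n
   Q@_e * ((x l * (e (idx_x q r l))%:R) * (y m * (e (idx_y p r m))%:R)
     * (z n * (e (idx_z p q n))%:R))).
  rewrite big_seq [RHS]big_seq; apply: eq_bigr => e /hQ[ex ey ez].
  rewrite -mul_sum3 !big_split_ord /=; congr (_ * (_ * _ * _)).
  - rewrite -(sum1_prod_exp x ex); apply: eq_bigr => l _.
    by rewrite (tnth_block_x x y z).
  - rewrite -(sum1_prod_exp y ey); apply: eq_bigr => l _.
    by rewrite (tnth_block_y x y z).
  - rewrite -(sum1_prod_exp z ez); apply: eq_bigr => l _.
    by rewrite (tnth_block_z x y z).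
rewrite exchange_big; apply: eq_bigr => l _.
rewrite exchange_big; apply: eq_bigr => m _.
rewrite exchange_big; apply: eq_bigr => n _.
by rewrite mulr_suml; apply: eq_bigr => e _; ring.
Qed.

Lemma trilinear_form_meval a i j k :
  (trilinear_form a).@[tnth (block_tuple (fun i' => (i' == i)%:R)
     (fun j' => (j' == j)%:R) (fun k' => (k' == k)%:R))] = a i j k.
Proof.
rewrite /trilinear_form raddf_sum (bigD1 i) //= [X in _ + X]big1 => [|i' /negPf ii'].
  rewrite raddf_sum (bigD1 j) //= [X in _ + X + _]big1 => [|j' /negPf jj'].
    rewrite raddf_sum (bigD1 k) //= [X in _ + X + _ + _]big1 => [|k' /negPf kk'].
      by rewrite /= mevalZ !mevalM !mevalXU !tnth_block !eqxx !mulr1 !addr0.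
    by rewrite /= mevalZ !mevalM !mevalXU !tnth_block kk' !mulr0.
  rewrite raddf_sum big1 // => k' _.
  by rewrite /= mevalZ !mevalM !mevalXU !tnth_block jj' !(mulr0, mul0r).
rewrite raddf_sum big1 // => j' _; rewrite raddf_sum big1 // => k' _.
by rewrite /= mevalZ !mevalM !mevalXU !tnth_block ii' !(mulr0, mul0r).
Qed.

Lemma meval_linear_form n I (c : 'I_2 -> K) (f : 'I_2 -> 'I_n) (v : 'I_n -> K) :
  (forall i, v (f i) = (i == I)%:R) ->
  (\sum_i c i *: 'X_(f i) : {mpoly K[n]}).@[v] = c I.
Proof.
move=> vf; rewrite raddf_sum (bigD1 I) //= big1 => [|i /negPf iI].
  by rewrite /= mevalZ mevalXU vf eqxx mulr1 addr0.
by rewrite /= mevalZ mevalXU vf iI mulr0.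
Qed.

Lemma format_achieved_tucker a p q r : format_achieved a p q r -> tucker a p q r.
Proof.
case=> cx [cy [cz [Q [/trihomogeneous_meval[t tQ] aQ]]]].
exists (fun l i => cx l i), (fun m j => cy m j), (fun n k => cz n k), t => i j k.
(* Evaluation at unit vectors turns the polynomial identity into one equation per entry: each linear
   form takes its coefficient as value. *)
rewrite -tQ -trilinear_form_meval aQ comp_mpoly_meval.
apply: meval_eq => s; rewrite !tnth_mktuple.
case: splitP => [s' _|n _]; first case: splitP => [l _|m _].
- by apply: meval_linear_form => i'; rewrite tnth_block.
- by apply: meval_linear_form => i'; rewrite tnth_block.
- by apply: meval_linear_form => i'; rewrite tnth_block.
Qed.

Lemma tucker_format_achieved a p q r : tucker a p q r -> format_achieved a p q r.
Proof.
case=> cx [cy [cz [t at_]]].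
exists (\matrix_(l, i) cx l i), (\matrix_(m, j) cy m j), (\matrix_(n, k) cz n k).
pose mon l m n : 'X_{1..p + q + r} :=
  (U_(idx_x q r l) + U_(idx_y p r m) + U_(idx_z p q n))%MM.
exists (\sum_l \sum_m \sum_n t l m n *: 'X_[mon l m n]); split.
  (* Every monomial in the support is some [mon l m n], whose degree in each block is 1. *)
  move=> e; rewrite mcoeff_msupp => e0.
  have /existsP[l /existsP[m /existsP[n /eqP ->]]] :
      [exists l, exists m, exists n, e == mon l m n].
    apply: contraNT e0 => ne; rewrite !raddf_sum big1 // => l _.
    rewrite raddf_sum big1 // => m _; rewrite raddf_sum big1 // => n _ /=.
    rewrite mcoeffZ mcoeffX; case: eqP => [en|_]; last by rewrite mulr0.
    case/negP: ne; apply/existsP; exists l; apply/existsP; exists m.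
    by apply/existsP; exists n; rewrite en.
  have delta d (l0 : 'I_d) : (\sum_l' (l0 == l'))%N = 1%N.
    by rewrite (bigD1 l0) //= eqxx big1 // => l' /negPf; rewrite eq_sym => ->.
  split.
  - rewrite -[RHS](delta p l); apply: eq_bigr => i _.
    by rewrite !mnmDE !mnm1E /idx_x /idx_y /idx_z
      !(eq_lshift, eq_rshift, eq_lrshift, eq_rlshift) !addn0.
  - rewrite -[RHS](delta q m); apply: eq_bigr => i _.
    by rewrite !mnmDE !mnm1E /idx_x /idx_y /idx_z
      !(eq_lshift, eq_rshift, eq_lrshift, eq_rlshift) addn0.
  - rewrite -[RHS](delta r n); apply: eq_bigr => i _.
    by rewrite !mnmDE !mnm1E /idx_x /idx_y /idx_z
      !(eq_lshift, eq_rshift, eq_lrshift, eq_rlshift).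
rewrite !raddf_sum /trilinear_form.
transitivity (\sum_l \sum_m \sum_n \sum_i \sum_j \sum_k
   (t l m n * (cx l i * cy m j * cz n k)) *:
     ('X_(idx_x 2 2 i) * 'X_(idx_y 2 2 j) * 'X_(idx_z 2 2 k))
     : {mpoly K[2 + 2 + 2]}).
  (* The entries of A are expanded by [at_], and the sums over the core indices are moved
     outside. *)
  under eq_bigr do under eq_bigr do under eq_bigr do
    (rewrite at_ scaler_suml; under eq_bigr do
      (rewrite scaler_suml; under eq_bigr do rewrite scaler_suml)).
  under eq_bigr do under eq_bigr do rewrite exchange_sum3.
  under eq_bigr do rewrite exchange_sum3.
  by rewrite exchange_sum3.
apply: eq_bigr => l _; rewrite raddf_sum; apply: eq_bigr => m _.
rewrite raddf_sum; apply: eq_bigr => n _.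
rewrite /= comp_mpolyZ !mpolyXD !rmorphM /= !comp_mpolyXU -!tnth_nth !tnth_block.
rewrite -mul_mpolyC mul_sum3.
apply: eq_bigr => i _; apply: eq_bigr => j _; apply: eq_bigr => k _.
by rewrite !mxE -!mul_mpolyC; ring.
Qed.

End EssentialFormat.

(** * Rank, conciseness and format in each case *)

Section Classification.
Variable K : fieldType.
Implicit Types a : hypermatrix222 K.

(** Passing through Tucker decompositions replaces a renaming of polynomial variables by a
    permutation of indices. *)
Lemma format_achieved_swapxy a p q r :
  format_achieved a p q r -> format_achieved (swapxy a) q p r.
Proof. by move/format_achieved_tucker/tucker_swapxy/tucker_format_achieved. Qed.

Lemma format_achieved_rotz a p q r :
  format_achieved a p q r -> format_achieved (rotz a) r p q.
Proof. by move/format_achieved_tucker/tucker_rotz/tucker_format_achieved. Qed.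

Lemma essential_format_swapxy a p q r :
  essential_format (swapxy a) q p r -> essential_format a p q r.
Proof.
case=> /format_achieved_swapxy ar amin; split=> // p' q' r'.
by move/format_achieved_swapxy/amin => [].
Qed.

Lemma essential_format_rotz a p q r :
  essential_format (rotz a) r p q -> essential_format a p q r.
Proof.
case=> /format_achieved_rotz/format_achieved_rotz ar amin; split=> // p' q' r'.
by move/format_achieved_rotz/amin => [].
Qed.

Lemma separable_format a : separable a -> format_achieved a 1 2 2.
Proof.
case=> c [b ab]; apply: tucker_format_achieved.
exists (fun=> c), (fun m j => (m == j)%:R), (fun n k => (n == k)%:R), (fun=> b).
move=> i j k; rewrite big_ord1 (bigD1 j) //= [X in _ + X]big1 => [|m /negPf mj].
  rewrite (bigD1 k) //= big1 => [|n /negPf nk]; last by rewrite nk !mulr0.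
  by rewrite !eqxx ab !mulr1 !addr0 mulrC.
by rewrite big1 // => n _; rewrite mj !(mulr0, mul0r).
Qed.

Lemma decomposable1_format a :
  sum_of_decomposables a 1 -> format_achieved a 1 1 1.
Proof.
move/decomposable1P=> [u [v [w auvw]]]; apply: tucker_format_achieved.
exists (fun=> u), (fun=> v), (fun=> w), (fun _ _ _ => 1) => i j k.
by rewrite !big_ord1 mul1r auvw.
Qed.

Lemma format_achieved222 a : format_achieved a 2 2 2.
Proof.
apply: tucker_format_achieved.
exists (fun l i => (l == i)%:R), (fun m j => (m == j)%:R),
  (fun n k => (n == k)%:R), a => i j k.
rewrite (bigD1 i) //= [X in _ + X]big1 => [|l /negPf li].
  rewrite (bigD1 j) //= [X in _ + X + _]big1 => [|m /negPf mj].
    rewrite (bigD1 k) //= big1 => [|n /negPf nk]; last by rewrite nk !mulr0.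
    by rewrite !eqxx !mulr1 !addr0.
  by rewrite big1 // => n _; rewrite mj !(mulr0, mul0r).
by rewrite big1 // => m _; rewrite big1 // => n _; rewrite li !(mulr0, mul0r).
Qed.

Lemma format_achieved_separable a p q r : (p <= 1)%N ->
  format_achieved a p q r -> separable a.
Proof. by move=> p1 /format_achieved_tucker; apply: tucker_separable. Qed.

Lemma concise_not_separable a : concise a -> ~ separable a.
Proof. by case=> _ amin /separable_format/amin []. Qed.

Lemma concise_swapxy a : concise a -> concise (swapxy a).
Proof. by move=> ca; apply: essential_format_swapxy. Qed.

Lemma concise_rotz a : concise a -> concise (rotz a).
Proof. by move=> ca; do 2 apply: essential_format_rotz. Qed.

(** A format with a component at most 1 bounds the rank of the corresponding flattening by one. *)
Lemma not_separable_concise a : ~ separable a -> ~ separable (swapxy a) ->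
  ~ separable (rotz a) -> concise a.
Proof.
move=> nx ny nz; split=> [|p q r apqr]; first exact: format_achieved222.
split; rewrite ltnNge; apply/negP => le1.
- exact: nx (format_achieved_separable le1 apqr).
- exact: ny (format_achieved_separable le1 (format_achieved_swapxy apqr)).
- exact: nz (format_achieved_separable le1 (format_achieved_rotz apqr)).
Qed.

Lemma separable_hyperdet a : separable a -> hyperdet a = 0.
Proof.
case/separable_dets; rewrite det_matM => /det_matL_eq0_hyperdet.
by rewrite hyperdet_swapxy.
Qed.

Lemma hyperdet_concise a : hyperdet a != 0 -> concise a.
Proof.
move/eqP=> a0; apply: not_separable_concise => /separable_hyperdet //.
- by rewrite hyperdet_swapxy.
- by rewrite hyperdet_rotz.
Qed.

(** A flattening of rank at most one along x kills det M; along y or z it kills det L. *)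
Lemma dets_neq0_concise a : \det (matL a) != 0 -> \det (matM a) != 0 -> concise a.
Proof.
move=> L0 M0; apply: not_separable_concise => /separable_dets [].
- by move/eqP; rewrite (negPf M0).
- by move/eqP; rewrite det_matM (negPf L0).
- by move/eqP; rewrite det_matM_rotz (negPf L0).
Qed.

Lemma rank_gt1 a : \det (matL a) != 0 ->
  forall s, sum_of_decomposables a s -> (2 <= s)%N.
Proof.
move=> L0 s as_; rewrite ltnNge; apply: contra_neqN L0 => s1.
by apply: decomposable1_det; apply: sum_of_decomposables_leq as_.
Qed.

Lemma rank2_two_zeros a : two_distinct_zeros (\det (matL a)) -> tensor_rank a 2.
Proof.
move=> tz; split; first exact: two_distinct_zeros_decomposable2.
apply: rank_gt1; apply: contraNneq (two_distinct_zeros_hyperdet tz).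
by move/det_matL_eq0_hyperdet ->.
Qed.

Lemma rank3_double_roots a : double_root (\det (matL a)) ->
  \det (matL a) != 0 -> \det (matM a) != 0 -> tensor_rank a 3.
Proof.
move=> dr L0 M0; split; first exact: double_root_decomposable3.
move=> s as_; rewrite ltnNge; apply/negP => s2.
case: (decomposable2_det (sum_of_decomposables_leq s2 as_)).
- exact: double_root_hyperdet.
- by move/eqP; rewrite (negPf L0).
- by move/eqP; rewrite (negPf M0).
Qed.

Lemma separable_rank2 a : separable a -> \det (matL a) != 0 -> tensor_rank a 2.
Proof.
move=> [c [b ab]] L0; split; last exact: rank_gt1.
have [u [v [w h]]] := slice_decomposable2 c b.
by exists u, v, w => i j k; rewrite ab h.
Qed.

(** The first component is positive because A is nonzero. A second or third component at most 1
    would force det L = 0. *)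
Lemma separable_essential_format a : (exists i j k, a i j k != 0) ->
  separable a -> \det (matL a) != 0 -> essential_format a 1 2 2.
Proof.
move=> nz sa L0; split=> [|p q r apqr]; first exact: separable_format.
split.
- exact: tucker_gt0 nz (format_achieved_tucker apqr).
- rewrite ltnNge; apply: contra_neqN L0 => le1.
  by case: (separable_dets (format_achieved_separable le1
    (format_achieved_swapxy apqr))).
- rewrite ltnNge; apply: contra_neqN L0 => le1.
  case: (separable_dets (format_achieved_separable le1
    (format_achieved_rotz apqr))).
  by rewrite det_matM_rotz.
Qed.

(** From det M = det N = 0, A is the product of c and b. Then det L = det b (c.x)^2, so det b = 0
    and b is itself a product of two vectors. *)
Lemma dets_eq0_decomposable1 a : (2 : K) != 0 -> (exists i j k, a i j k != 0) ->
  \det (matL a) = 0 -> \det (matM a) = 0 -> \det (matN a) = 0 ->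
  sum_of_decomposables a 1.
Proof.
move=> two0 [i [j [k aijk]]] /det_matL_eq0P[p0 _ p2] M0 N0.
have [c [b ab]] := dets_separable two0 M0 N0.
have ci : c i != 0 by apply: contraNneq aijk => ci0; rewrite ab ci0 mul0r.
have cdet : forall l, c l ^+ 2 * (b 0 0 * b 1 1 - b 0 1 * b 1 0) = 0.
  apply: ord2P; first by rewrite -[RHS]p0 /pencil0 !ab; ring.
  by rewrite -[RHS]p2 /pencil2 !ab; ring.
have /slice_decomposable1-/(_ c)[u [v [w h]]] : b 0 0 * b 1 1 = b 0 1 * b 1 0.
  apply/eqP; rewrite -subr_eq0; move/eqP: (cdet i).
  by rewrite mulf_eq0 sqrf_eq0 (negPf ci).
by exists u, v, w => i' j' k'; rewrite ab h.
Qed.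

Lemma decomposable1_rank a : (exists i j k, a i j k != 0) ->
  sum_of_decomposables a 1 -> tensor_rank a 1.
Proof.
move=> [i [j [k aijk]]] a1; split=> // -[|//] [u [v [w a0]]].
by rewrite a0 big_ord0 eqxx in aijk.
Qed.

Lemma neq0_swapxy a :
  (exists i j k, a i j k != 0) -> exists i j k, swapxy a i j k != 0.
Proof. by move=> [i [j [k aijk]]]; exists j, i, k. Qed.

Lemma neq0_rotz a :
  (exists i j k, a i j k != 0) -> exists i j k, rotz a i j k != 0.
Proof. by move=> [i [j [k aijk]]]; exists k, i, j. Qed.

Lemma decomposable1_essential_format a : (exists i j k, a i j k != 0) ->
  sum_of_decomposables a 1 -> essential_format a 1 1 1.
Proof.
move=> nz a1; split=> [|p q r]; first exact: decomposable1_format.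
move/format_achieved_tucker => apqr; split.
- exact: tucker_gt0 nz apqr.
- exact: tucker_gt0 (neq0_swapxy nz) (tucker_swapxy apqr).
- exact: tucker_gt0 (neq0_rotz nz) (tucker_rotz apqr).
Qed.

Lemma double_root_matL_rank_format a :
  (2 : K) != 0 -> (exists i j k, a i j k != 0) ->
  nonzero_with_double_root (\det (matL a)) ->
  \det (matM a) = 0 -> \det (matN a) = 0 ->
  [/\ hyperdet a = 0, ~ concise a, tensor_rank a 2 & essential_format a 1 2 2].
Proof.
move=> two0 nz [L0 Ldr] M0 N0; have sep := dets_separable two0 M0 N0.
split; first exact: double_root_hyperdet.
- by move/concise_not_separable.
- exact: separable_rank2.
- exact: separable_essential_format.
Qed.

Lemma double_root_matM_rank_format a :
  (2 : K) != 0 -> (exists i j k, a i j k != 0) ->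
  \det (matL a) = 0 -> nonzero_with_double_root (\det (matM a)) ->
  \det (matN a) = 0 ->
  [/\ hyperdet a = 0, ~ concise a, tensor_rank a 2 & essential_format a 2 1 2].
Proof.
move=> two0 nz L0 Mdr N0.
rewrite -det_matM_swapxy in L0; rewrite det_matM in Mdr.
rewrite -det_matN_swapxy in N0.
have [h nc rk ef] := double_root_matL_rank_format two0 (neq0_swapxy nz) Mdr L0 N0.
split; first by rewrite -hyperdet_swapxy.
- by move/concise_swapxy.
- exact: tensor_rank_swapxy.
- exact: essential_format_swapxy.
Qed.

Lemma double_root_matN_rank_format a :
  (2 : K) != 0 -> (exists i j k, a i j k != 0) ->
  \det (matL a) = 0 -> \det (matM a) = 0 ->
  nonzero_with_double_root (\det (matN a)) ->
  [/\ hyperdet a = 0, ~ concise a, tensor_rank a 2 & essential_format a 2 2 1].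
Proof.
move=> two0 nz L0 M0 Ndr.
rewrite -det_matM_rotz in L0; rewrite -det_matN_rotz in M0.
rewrite det_matN in Ndr.
have [h nc rk ef] := double_root_matL_rank_format two0 (neq0_rotz nz) Ndr L0 M0.
split; first by rewrite -hyperdet_rotz.
- by move/concise_rotz.
- exact: tensor_rank_rotz.
- exact: essential_format_rotz.
Qed.

(** The zero form counts as having a double root, with cofactor 0, so all three forms can be treated
    alike. *)
Lemma hyperdet_double_roots a : (2 : K) != 0 -> hyperdet a = 0 ->
  [/\ double_root (\det (matL a)), double_root (\det (matM a))
    & double_root (\det (matN a))].
Proof.
move=> two0 a0; split; first exact: (hyperdet_double_root two0).
- by rewrite det_matM; apply: (hyperdet_double_root two0); rewrite hyperdet_swapxy.
- by rewrite det_matN; apply: (hyperdet_double_root two0); rewrite hyperdet_rotz.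
Qed.

Lemma hyperdet0_cases a : (2 : K) != 0 -> hyperdet a = 0 ->
  let dL := \det (matL a) in
  let dM := \det (matM a) in
  let dN := \det (matN a) in
  [\/ [/\ nonzero_with_double_root dL, nonzero_with_double_root dM &
          nonzero_with_double_root dN],
      [\/ [/\ nonzero_with_double_root dL, dM = 0 & dN = 0],
          [/\ dL = 0, nonzero_with_double_root dM & dN = 0] |
          [/\ dL = 0, dM = 0 & nonzero_with_double_root dN]] |
      [/\ dL = 0, dM = 0 & dN = 0]].
Proof.
move=> two0 a0 dL dM dN; have [rL rM rN] := hyperdet_double_roots two0 a0.
(* Applied in each of the three directions, this rules out that exactly one form vanishes. *)
have LMN : dL = 0 -> dM = 0 \/ dN = 0 by exact: det_matL_eq0_or.
have MLN : dM = 0 -> dL = 0 \/ dN = 0.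
  rewrite /dM det_matM => /det_matL_eq0_or.
  by rewrite det_matM_swapxy det_matN_swapxy.
have NLM : dN = 0 -> dL = 0 \/ dM = 0.
  rewrite /dN det_matN => /det_matL_eq0_or.
  by rewrite det_matM_rotz det_matN_rotz.
have [L0|L0] := eqVneq dL 0; have [M0|M0] := eqVneq dM 0;
  have [N0|N0] := eqVneq dN 0.
- by apply: Or33.
- by apply: Or32; apply: Or33.
- by apply: Or32; apply: Or32.
- by case: (LMN L0) => /eqP; rewrite ?(negPf M0) ?(negPf N0).
- by apply: Or32; apply: Or31.
- by case: (MLN M0) => /eqP; rewrite ?(negPf L0) ?(negPf N0).
- by case: (NLM N0) => /eqP; rewrite ?(negPf L0) ?(negPf M0).
- by apply: Or31.
Qed.

(** The cases differ in the number of vanishing forms: none, two or three. *)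
Lemma double_root_cases_exclusive (f g h : {mpoly K[2]}) :
  let c2 := [/\ nonzero_with_double_root f, nonzero_with_double_root g &
                nonzero_with_double_root h] in
  let c3 := [\/ [/\ nonzero_with_double_root f, g = 0 & h = 0],
                [/\ f = 0, nonzero_with_double_root g & h = 0] |
                [/\ f = 0, g = 0 & nonzero_with_double_root h]] in
  let c4 := [/\ f = 0, g = 0 & h = 0] in
  [/\ c2 -> ~ c3, c2 -> ~ c4 & c3 -> ~ c4].
Proof.
rewrite /nonzero_with_double_root; split.
- by move=> [[/eqP f0 _] [/eqP g0 _] _] [] [].
- by move=> [[/eqP f0 _] _ _] [].
- by case=> [[[/eqP f0 _] _ _]|[_ [/eqP g0 _] _]|[_ _ [/eqP h0 _]]] [].
Qed.

End Classification.
Theorem mainTheorem3 (R : realType) (A : hypermatrix222 R[i])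
    (A_neq0 : exists i j k, A i j k != 0) :
  let dL := \det (matL A) in
  let dM := \det (matM A) in
  let dN := \det (matN A) in
  let case1 := two_distinct_zeros dL in
  let case2 := [/\ nonzero_with_double_root dL,
                   nonzero_with_double_root dM &
                   nonzero_with_double_root dN] in
  let case3L := [/\ nonzero_with_double_root dL, dM = 0 & dN = 0] in
  let case3M := [/\ dL = 0, nonzero_with_double_root dM & dN = 0] in
  let case3N := [/\ dL = 0, dM = 0 & nonzero_with_double_root dN] in
  let case3 := [\/ case3L, case3M | case3N] in
  let case4 := [/\ dL = 0, dM = 0 & dN = 0] in
  exactly_one [:: case1; case2; case3; case4]
  /\ (case1 -> [/\ hyperdet A != 0, concise A & tensor_rank A 2])
  /\ (case2 -> [/\ hyperdet A = 0, concise A & tensor_rank A 3])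
  /\ (case3 -> [/\ hyperdet A = 0, ~ concise A & tensor_rank A 2])
  /\ (case3L -> essential_format A 1 2 2)
  /\ (case3M -> essential_format A 2 1 2)
  /\ (case3N -> essential_format A 2 2 1)
  /\ (case4 -> [/\ hyperdet A = 0, tensor_rank A 1, ~ concise A &
                   essential_format A 1 1 1])
  /\ (double_root dL \/ dL = 0 ->
        [/\ degenerate dL, degenerate dM & degenerate dN]).
Proof.
move=> dL dM dN case1 case2 case3L case3M case3N case3 case4.
have two0 : (2 : R[i]) != 0 by rewrite Num.Theory.pnatr_eq0.
have h1 : case1 -> hyperdet A != 0 by exact: two_distinct_zeros_hyperdet.
have h2 : case2 -> hyperdet A = 0.
  by case=> [[_ rL] _ _]; apply: double_root_hyperdet.
have s3L : case3L -> [/\ hyperdet A = 0, ~ concise A, tensor_rank A 2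
    & essential_format A 1 2 2].
  by case=> L M N; exact: (double_root_matL_rank_format two0 A_neq0 L M N).
have s3M : case3M -> [/\ hyperdet A = 0, ~ concise A, tensor_rank A 2
    & essential_format A 2 1 2].
  by case=> L M N; exact: (double_root_matM_rank_format two0 A_neq0 L M N).
have s3N : case3N -> [/\ hyperdet A = 0, ~ concise A, tensor_rank A 2
    & essential_format A 2 2 1].
  by case=> L M N; exact: (double_root_matN_rank_format two0 A_neq0 L M N).
have s3 : case3 -> [/\ hyperdet A = 0, ~ concise A & tensor_rank A 2].
  by case=> [/s3L|/s3M|/s3N] [].
have h3 : case3 -> hyperdet A = 0 by case/s3.
have h4 : case4 -> hyperdet A = 0 by case=> /det_matL_eq0_hyperdet.
have [n23 n24 n34] := double_root_cases_exclusive dL dM dN.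
split.
  (* Det(A) separates the first case from the others. Cases are numbered from 0 in the list, and an
     index past its end gives the default [False]. *)
  have [a0|a0] := eqVneq (hyperdet A) 0.
    have n1 : ~ case1 by move/h1; rewrite a0 eqxx.
    case: (hyperdet0_cases two0 a0) => c.
    - by exists 1%N; split=> // -[|[|[|[|j]]]] //= => [/(n23 c)|/(n24 c)|];
        rewrite ?nth_nil.
    - by exists 2%N; split=> // -[|[|[|[|j]]]] //= => [/n23|/(n34 c)|];
        rewrite ?nth_nil.
    - by exists 3%N; split=> // -[|[|[|[|j]]]] //= => [/n24|/n34|]; rewrite ?nth_nil.
  have c1 : case1.
    (* The complex square root of Det(A) supplies the root of the discriminant. *)
    exact: hyperdet_two_distinct_zeros two0 a0 (Num.Theory.sqrtCK _).
  exists 0%N; split=> // -[|[|[|[|j]]]] //=.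
  - by move/h2/eqP; rewrite (negPf a0).
  - by move/h3/eqP; rewrite (negPf a0).
  - by move/h4/eqP; rewrite (negPf a0).
  - by rewrite nth_nil.
split.
  move=> c1; split; first exact: h1.
    by apply: hyperdet_concise; apply: h1.
  exact: rank2_two_zeros.
split.
  move=> c2; split; first exact: h2.
    by case: c2 => [[L0 _] [M0 _] _]; exact: (dets_neq0_concise L0 M0).
  by case: c2 => [[L0 rL] [M0 _] _]; exact: (rank3_double_roots rL L0 M0).
do 4 (split; first by [exact: s3 | case/s3L | case/s3M | case/s3N]).
split.
  move=> c4; case: (c4) => L0 M0 N0.
  have a1 : sum_of_decomposables A 1 := dets_eq0_decomposable1 two0 A_neq0 L0 M0 N0.
  split; first exact: h4.
  - exact: (decomposable1_rank A_neq0 a1).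
  - by move/concise_not_separable; apply; apply: decomposable1_separable.
  - exact: (decomposable1_essential_format A_neq0 a1).
(* Either alternative gives Det(A) = 0, a condition symmetric in the three directions. *)
move=> rL; have a0 : hyperdet A = 0.
  by case: rL => [/double_root_hyperdet|/det_matL_eq0_hyperdet].
have [drL drM drN] := hyperdet_double_roots two0 a0.
split; [exact: double_root_degenerate drL | exact: double_root_degenerate drM
  | exact: double_root_degenerate drN].
Qed.
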